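(* Let $A\cup B$ be a partition of a set of $n$ points in the plane into two nonempty sets $A$ and $B$, such that every $AB$-line contains at most $\ell$ of the $n$ points. Then the bivisibility graph $\mathcal{B}(A,B)$ contains a non-crossing forest with at least $\frac{n-1}{\ell-1}$ edges. In particular, if $\ell=2$ then $\mathcal{B}(A,B)$ contains a non-crossing spanning tree.
   Context: An $AB$-line is a line containing at least one point of $A$ and at least one point of $B$. For disjoint finite point sets $A,B$ in the plane, the bivisibility graph $\mathcal{B}(A,B)$ has vertex set $A\cup B$, where $v\in A$ and $w\in B$ are adjacent iff no point of $A\cup B$ lies in the open segment $vw$. Edges are drawn as straight segments; a subgraph is non-crossing if no two of its edges intersect except at a common endpoint. *)

(* Defs.v *)
From HB Require Import structures.
From mathcomp Require Import all_boot all_order all_algebra finmap.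
From mathcomp Require Import boolp classical_sets reals.

Set Implicit Arguments.
Unset Strict Implicit.
Unset Printing Implicit Defensive.

Import Order.TTheory GRing.Theory Num.Theory.
Local Open Scope fset_scope.
Local Open Scope ring_scope.

Record sgraph (T : choiceType) := SGraph {
  vertices : {fset T};
  edges : {fset {fset T}};
  edgesP : forall e, e \in edges -> e `<=` vertices /\ #|` e| = 2%N }.

Section Graphs.
Variable T : choiceType.
Implicit Types G H : sgraph T.

Definition adj G : rel T := fun x y => [fset x; y] \in edges G.

Definition subgraph H G :=
  vertices H `<=` vertices G /\ edges H `<=` edges G.

Definition forest G := forall c : seq T, (2 < size c)%N -> ~ ucycle (adj G) c.

Definition connected G :=
  forall x y, x \in vertices G -> y \in vertices G ->
    exists2 p, path (adj G) x p & last x p = y.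

Definition tree G := [/\ vertices G != fset0, connected G & forest G].

Definition spanning H G := subgraph H G /\ vertices H = vertices G.

End Graphs.

Section Plane.
Variable R : realType.
Local Notation point := 'rV[R]_2.

Definition is_line (L : set point) :=
  exists q d : point, d != 0 /\ L = [set p : point | exists t : R, p = (q + t *: d)%R]%classic.

Definition AB_line (A B : {fset point}) (L : set point) :=
  [/\ is_line L, exists2 a, a \in A & L a & exists2 b, b \in B & L b].

Definition open_segment (v w : point) : set point :=
  [set p : point | exists t : R, (0 < t < 1)%R /\ p = ((1 - t) *: v + t *: w)%R]%classic.

Definition closed_segment (v w : point) : set point :=
  [set p : point | exists t : R, (0 <= t <= 1)%R /\ p = ((1 - t) *: v + t *: w)%R]%classic.

Definition bivisible (A B : {fset point}) (v w : point) :=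
  [/\ v \in A, w \in B & forall p, p \in A `|` B -> ~ open_segment v w p].

(* The cardinality test is automatic when A and B are disjoint; it makes the
   definition a simple graph for all A and B. *)
Definition bivis_edges (A B : {fset point}) : {fset {fset point}} :=
  [fset e in fpowerset (A `|` B) | (#|` e| == 2%N) &&
     `[< exists v w, e = [fset v; w] /\ bivisible A B v w >]].

Lemma bivis_edgesP (A B : {fset point}) e :
  e \in bivis_edges A B -> e `<=` A `|` B /\ #|` e| = 2%N.
Proof. by rewrite !inE /= fpowersetE => /and3P[-> /eqP-> _]. Qed.

Definition bivisibility_graph (A B : {fset point}) : sgraph point :=
  SGraph (@bivis_edgesP A B).

Definition drawn_edge (e : {fset point}) : set point :=
  [set p : point | exists v w, e = [fset v; w]%fset /\ closed_segment v w p]%classic.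

Definition non_crossing (G : sgraph point) :=
  forall e f, e \in edges G -> f \in edges G -> e != f ->
    forall p, drawn_edge e p -> drawn_edge f p -> p \in e `&` f.

End Plane.

(* Main.v *)
Require Import Defs.
From HB Require Import structures.
From mathcomp Require Import all_boot all_order all_algebra finmap.
From mathcomp Require Import boolp classical_sets reals.
From mathcomp Require Import ring lra.

(** Let [v] be an extreme point of the configuration, say [v] in [A], and sweep
    the rays from [v]. On every ray meeting [B], take the point [b] of [B]
    closest to [v]; these points govern the wedges between consecutive such
    rays. Every point of [A] is joined to the [b] governing its wedge whenever
    it sees it, and [v] to all the [b] it sees. An edge stays in the wedge of its
    [b], so edges at different [b] meet only at [v], and edges at the same [b]
    are separated by visibility. Points of [A] other than [v] have degree at
    most one, which excludes cycles. Each point other than [v] lies on the line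
    of some edge and is charged to it; such a line carries at most [l - 1]
    charged points, because it also contains [v], or an uncharged [b]. *)

Set Implicit Arguments.
Unset Strict Implicit.
Unset Printing Implicit Defensive.

Import Order.TTheory GRing.Theory Num.Theory.
Local Open Scope fset_scope.
Local Open Scope ring_scope.

(** * Finite minima, covering bounds and neighbours on a cycle *)

Lemma seq_argmin (R : realType) (T : eqType) (f : T -> R) (s : seq T) (Q : T -> Prop) :
  (exists2 x, x \in s & Q x) ->
  exists x, [/\ x \in s, Q x & forall y, y \in s -> Q y -> f x <= f y].
Proof.
elim: s => [|a s IH] [x]; first by rewrite in_nil.
move=> xs Qx.
case: (pselect (exists2 x, x \in s & Q x)) => [/IH[z [zs Qz zmin]]|nex].
- case: (pselect (Q a /\ f a < f z)) => [[Qa az]|naz].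
    exists a; split=> //; first exact: mem_head.
    move=> y; rewrite inE => /orP[/eqP->//|ys] Qy.
    by apply: le_trans (ltW az) _; apply: zmin.
  exists z; split=> //; first by rewrite inE zs orbT.
  move=> y; rewrite inE => /orP[/eqP->|ys] Qy; last exact: zmin.
  by rewrite leNgt; apply/negP => az; apply: naz.
- have Hs y : y \in a :: s -> Q y -> y = a.
    by rewrite inE => /orP[/eqP//|ys] Qy; case: nex; exists y.
  exists x; split=> // y ys Qy.
  by rewrite (Hs x) // (Hs y).
Qed.

Lemma exists_notin (R : realType) (s : seq R) : exists x, x \notin s.
Proof.
suff [x xP] : exists x, forall y, y \in s -> y < x.
  by exists x; apply/negP => /xP; rewrite ltxx.
elim: s => [|a s [x xP]]; first by exists 0.
exists (Num.max x (a + 1)) => y; rewrite inE lt_max => /orP[/eqP->|/xP->//].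
by rewrite ltrDl ltr01 orbT.
Qed.

Lemma card_fset_cover (I : eqType) (T : choiceType) (s : seq I) (C : I -> {fset T})
    (D : {fset T}) (k : nat) :
  (forall x, x \in D -> exists2 i, i \in s & x \in C i) ->
  (forall i, i \in s -> (#|` C i| <= k)%N) -> (#|` D| <= k * size s)%N.
Proof.
elim: s D => [|a s IH] D cov Ck.
  suff -> : D = fset0 by rewrite cardfs0.
  by apply/fsetP => x; rewrite in_fset0; apply/negP => /cov[].
rewrite -(cardfsID (C a) D) /= mulnS leq_add //.
  apply: leq_trans (Ck a (mem_head _ _)); apply: fsubset_leq_card.
  exact: fsubsetIr.
apply: IH => [x|i is_]; last by apply: Ck; rewrite inE is_ orbT.
rewrite inE => /andP[xC /cov[i]]; rewrite inE => /orP[/eqP->|is_ xi].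
  by rewrite (negPf xC).
by exists i.
Qed.

(** Successor and predecessor differ once a cycle has three vertices. Hence a vertex of degree at
    most one lies on no cycle. *)
Lemma ucycle_neighbors (T : eqType) (e : rel T) (c : seq T) (x : T) :
  ucycle e c -> (2 < size c)%N -> x \in c ->
  exists y w, [/\ y \in c, w \in c, y != w, e x y & e w x].
Proof.
move=> ec sc /rot_to[i s E].
have : ucycle e (rot i c) by rewrite rot_ucycle.
have memc : rot i c =i c by exact: mem_rot.
move: sc; rewrite -(size_rot i c); move: memc; rewrite E.
case: s {E} => [|y [|z s]] // memc _ /andP[].
rewrite /= rcons_path => /and3P[exy eyz /andP[_ ewx]] /and3P[_ yz _].
exists y, (last z s); split=> //.
- by rewrite -memc !inE eqxx orbT.
- by rewrite -memc; rewrite 2!(inE, in_cons) mem_last !orbT.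
- by apply: contraNneq yz => ->; exact: mem_last.
Qed.

(** * Lines and segments, and the symmetry between [A] and [B] *)

Section Segments.
Variable R : realType.
Local Notation point := 'rV[R]_2.

Definition line_through (a b : point) : set point :=
  [set p : point | exists t : R, p = (1 - t) *: a + t *: b]%classic.

Lemma is_line_through (a b : point) : a != b -> is_line (line_through a b).
Proof.
move=> ab; exists a, (b - a); split; first by rewrite subr_eq0 eq_sym.
rewrite predeqE => p; split=> -[t ->]; exists t;
  by rewrite scalerBl scale1r scalerBr addrAC addrA.
Qed.

Lemma closed_segmentC (a b : point) : closed_segment a b = closed_segment b a.
Proof.
rewrite predeqE => p; split=> -[t [tP ->]]; exists (1 - t); (split; first by lra);
  by rewrite addrC subKr.
Qed.

Lemma open_segmentC (a b : point) : open_segment a b = open_segment b a.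
Proof.
rewrite predeqE => p; split=> -[t [tP ->]]; exists (1 - t); (split; first by lra);
  by rewrite addrC subKr.
Qed.

Lemma fset2_eq (T : choiceType) (x y z w : T) : [fset x; y] = [fset z; w] ->
  (x = z /\ y = w) \/ (x = w /\ y = z).
Proof.
move=> /fsetP E.
have := E x; have := E y; have := E z; have := E w.
rewrite !inE !eqxx !orbT /= => /orP Hw /orP Hz /esym/orP Hy /esym/orP Hx.
case: Hx => /eqP Hx; case: Hy => /eqP Hy; subst; [|by left|by right|].
  by left; case: Hw => /eqP->.
by right; case: Hz => /eqP->.
Qed.

Lemma drawn_edgeE (a b : point) : drawn_edge [fset a; b] = closed_segment a b.
Proof.
rewrite predeqE => p; split=> [[x [y [/fset2_eq[[-> ->]|[-> ->]]]]]//|ab].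
  by rewrite closed_segmentC.
by exists a, b.
Qed.

Lemma bivis_edgesC (A B : {fset point}) : bivis_edges A B = bivis_edges B A.
Proof.
have sub (C D : {fset point}) e : e \in bivis_edges C D -> e \in bivis_edges D C.
  rewrite !inE /= fsetUC => /and3P[-> -> /asboolP[x [y [-> [xC yD vis]]]]] /=.
  apply/asboolP; exists y, x; split; first exact: fsetUC.
  by split=> // p; rewrite fsetUC open_segmentC => /vis.
by apply/fsetP => e; apply/idP/idP => /sub.
Qed.

Lemma AB_lineC (A B : {fset point}) L : AB_line A B L -> AB_line B A L.
Proof. by case. Qed.

End Segments.

(** * Slopes seen from an extreme point *)

Section Construction.
Variable R : realType.
Local Notation point := 'rV[R]_2.
(** [X] and [Y] stand for affine coordinates centred at [v] that put every other point in the open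
    right half-plane. Rays from [v] are then told apart by their slope, and [X] orders the points
    along a ray. *)
Variables (A B : {fset point}) (v : point) (X Y : point -> R).
Hypothesis disj_AB : [disjoint A & B].
Hypothesis vA : v \in A.
Hypothesis B_neq0 : B != fset0.
Hypothesis X_aff : forall (t : R) (a b : point), X ((1 - t) *: a + t *: b) = (1 - t) * X a + t * X b.
Hypothesis Y_aff : forall (t : R) (a b : point), Y ((1 - t) *: a + t *: b) = (1 - t) * Y a + t * Y b.
Hypothesis XY_inj : forall p q, X p = X q -> Y p = Y q -> p = q.
Hypothesis Xv : X v = 0.
Hypothesis Yv : Y v = 0.
Hypothesis X_gt0 : forall p : point, p \in A `|` B -> p != v -> 0 < X p.

(** At [v] the quotient is 0/0, evaluated as 0 and without geometric meaning; this is why [v] gets a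
    separate disjunct in [oriented_edge]. *)
Definition slope p := Y p / X p.

Definition first b := b \in B /\ forall b', b' \in B -> slope b' = slope b -> X b <= X b'.

(* The ray of [b] is the last one at or below slope [s], or, when every ray
   meeting [B] is above [s], the lowest one. *)
Definition governs (s : R) b := first b /\
  ((slope b <= s /\ forall b', b' \in B -> slope b' <= s -> slope b' <= slope b) \/
   (forall b', b' \in B -> s < slope b' /\ slope b <= slope b')).

Definition oriented_edge x b :=
  [/\ bivisible A B x b, first b & x = v \/ governs (slope x) b].

Lemma memA p : p \in A -> p \in A `|` B. Proof. by rewrite inE => ->. Qed.
Lemma memB p : p \in B -> p \in A `|` B. Proof. by rewrite inE orbC => ->. Qed.

Lemma notAB p : p \in A -> p \in B -> False.
Proof. by move=> pA pB; have /fdisjointP/(_ _ pA) := disj_AB; rewrite pB. Qed.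

Lemma B_neqv b : b \in B -> b != v.
Proof. by move=> bB; apply/eqP => bv; apply: (@notAB v) => //; rewrite -bv. Qed.

Lemma XB_gt0 b : b \in B -> 0 < X b.
Proof. by move=> bB; apply: X_gt0; [exact: memB | exact: B_neqv]. Qed.

Lemma X_ge0 p : p \in A `|` B -> 0 <= X p.
Proof. by move=> pP; have [->|/(X_gt0 pP)/ltW] := eqVneq p v; rewrite ?Xv. Qed.

Lemma slopeE p : 0 < X p -> Y p = slope p * X p.
Proof. by move=> Xp; rewrite /slope divfK // gt_eqF. Qed.

(** Wedges at [v] are convex: once the positive denominators are cleared, the inequality is affine
    along the segment. *)
Lemma slope_seg_ge m a b t : 0 < X a -> 0 < X b -> 0 <= t <= 1 ->
  m <= slope a -> m <= slope b -> m <= slope ((1 - t) *: a + t *: b).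
Proof.
move=> Xa Xb tP; rewrite /slope X_aff Y_aff !ler_pdivlMr //; last by nra.
by move=> *; nra.
Qed.

Lemma slope_seg_le m a b t : 0 < X a -> 0 < X b -> 0 <= t <= 1 ->
  slope a <= m -> slope b <= m -> slope ((1 - t) *: a + t *: b) <= m.
Proof.
move=> Xa Xb tP; rewrite /slope X_aff Y_aff !ler_pdivrMr //; last by nra.
by move=> *; nra.
Qed.

(** * Governing points: existence, uniqueness and stability along an edge *)

Lemma governs_first b : first b -> governs (slope b) b.
Proof. by move=> fb; split=> //; left. Qed.

(** Both candidates have the same slope, since the two clauses of [governs] exclude each other;
    being closest to [v] on the same ray, they also share [X]. *)
Lemma governs_inj s b b' : governs s b -> governs s b' -> b = b'.
Proof.
move=> [[bB bmin] H] [[b'B b'min] H'].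
have E : slope b = slope b'.
  apply/eqP; rewrite eq_le; case: H => [[h1 h2]|h]; case: H' => [[h1' h2']|h'].
  - by rewrite h2 // h2'.
  - by have [] := h' _ bB; rewrite ltNge h1.
  - by have [] := h _ b'B; rewrite ltNge h1'.
  - by have [_ ->] := h _ b'B; have [_ ->] := h' _ bB.
have EX : X b = X b' by apply/eqP; rewrite eq_le bmin ?b'min.
by apply: XY_inj => //; rewrite !slopeE ?XB_gt0 // E EX.
Qed.

Lemma first_exists b : b \in B -> exists2 b', first b' & slope b' = slope b.
Proof.
move=> bB.
have [|b' [b'B b's b'min]] := @seq_argmin R _ X B (fun c => slope c = slope b).
  by exists b.
by exists b' => //; split=> // c cB cs; apply: b'min => //; rewrite cs.
Qed.

Lemma governs_exists s : exists b, governs s b.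
Proof.
case: (pselect (exists2 b, b \in B & slope b <= s)) => [ex|nex].
  have [b [bB bs bmax]] := seq_argmin (fun c => - slope c) ex.
  have [b' fb' E] := first_exists bB.
  exists b'; split=> //; left; rewrite E; split=> // c cB cs.
  by rewrite -lerN2; apply: bmax.
have /fset0Pn[b0 b0B] := B_neq0.
have [|b [bB _ bmin]] := @seq_argmin R _ slope B (fun=> True); first by exists b0.
have [b' fb' E] := first_exists bB.
exists b'; split=> //; right=> c cB; rewrite E; split; last exact: bmin.
by rewrite ltNge; apply/negP => cs; apply: nex; exists c.
Qed.

(** An edge stays in the wedge of [b]: the slope moves monotonically from that of [q] to that of [b]
    without passing the ray of another governing point. *)
Lemma governs_seg q b t : q \in A `|` B -> first b -> (q = v \/ governs (slope q) b) ->
  0 <= t <= 1 -> (1 - t) *: q + t *: b != v ->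
  governs (slope ((1 - t) *: q + t *: b)) b.
Proof.
move=> qP fb; have [bB bmin] := fb; have Xb := XB_gt0 bB.
have [-> _ tP pv|qv [qv'|[_ H]] tP pv] := eqVneq q v; last 2 first.
- by rewrite qv' eqxx in qv.
- have Xq := X_gt0 qP qv.
  split=> //; case: H => [[h1 h2]|h].
  + left; split; first exact: slope_seg_ge.
    move=> c cB cs; apply: h2 => //; apply: le_trans cs _.
    exact: slope_seg_le.
  (* Here [q] lies below all rays meeting [B]. The moving point does too until it reaches the lowest
     ray, where the first clause of [governs] takes over. *)
  + have [qb bb] := h _ bB.
    have [lt|ge] := ltP (slope ((1 - t) *: q + t *: b)) (slope b).
      right=> c cB; have [_ bc] := h _ cB; split=> //.
      exact: lt_le_trans lt bc.
    left; split=> // c cB cs; apply: le_trans cs _.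
    by apply: slope_seg_le => //; exact: ltW.
(* From [v] the segment runs along the ray of [b], so the slope is constant away from [v]. *)
- have t0 : t != 0.
    apply: contra_neq pv => ->.
    by rewrite subr0 scale1r scale0r addr0.
  have -> : slope ((1 - t) *: v + t *: b) = slope b.
    rewrite /slope X_aff Y_aff Xv Yv !mulr0 !add0r invfM.
    by rewrite mulrACA divff // mul1r.
  exact: governs_first.
Qed.

(** The ray of [p] itself meets [B], so it is the last one at or below its own slope. *)
Lemma slope_governed b p : p \in B -> governs (slope p) b -> slope b = slope p.
Proof.
move=> pB [_ [[h1 h2]|/(_ _ pB)[]]]; last by rewrite ltxx.
by apply/eqP; rewrite eq_le h1 h2.
Qed.

(** * Finding a visible edge by walking towards a governing point *)

(** The taxicab distance in the coordinates [X], [Y]. It suffices because it is positive off [b] and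
    scales linearly along segments ending at [b]. *)
Definition dist1 b p := `|X p - X b| + `|Y p - Y b|.

Lemma dist1_seg b p t : t <= 1 ->
  dist1 b ((1 - t) *: p + t *: b) = (1 - t) * dist1 b p.
Proof.
move=> t1; rewrite /dist1 X_aff Y_aff.
have -> : (1 - t) * X p + t * X b - X b = (1 - t) * (X p - X b) by ring.
have -> : (1 - t) * Y p + t * Y b - Y b = (1 - t) * (Y p - Y b) by ring.
by rewrite !normrM ger0_norm ?subr_ge0 // mulrDr.
Qed.

Lemma dist1_gt0 b p : p != b -> 0 < dist1 b p.
Proof.
rewrite /dist1; apply: contra_neqT.
have := normr_ge0 (X p - X b); have := normr_ge0 (Y p - Y b) => y0 x0 d.
by apply: XY_inj; apply: subr0_eq; apply: normr0_eq0; lra.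
Qed.

Lemma comb_seg (q b : point) (t u : R) :
  (1 - u) *: ((1 - t) *: q + t *: b) + u *: b =
  (1 - (t + u - t * u)) *: q + (t + u - t * u) *: b.
Proof. by apply/rowP => i; rewrite !mxE; ring. Qed.

(** The last point [x] of the configuration before [b] on the segment from [q] sees [b]. It belongs
    to [A], because a point of [B] there would have to lie on the ray of [b]. *)
Lemma edge_toward q b : q \in A -> first b ->
  (q = v \/ (governs (slope q) b /\ slope q != slope b)) ->
  exists x t, [/\ 0 <= t < 1, x = (1 - t) *: q + t *: b & oriented_edge x b].
Proof.
move=> qA fb H; have [bB bmin] := fb; have Xb := XB_gt0 bB.
have qb : q != b by apply/eqP => qb; apply: (@notAB b) => //; rewrite -qb.
have qH : q = v \/ governs (slope q) b by case: H => [|[]]; [left|right].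
pose Q p := exists t, 0 <= t < 1 /\ p = (1 - t) *: q + t *: b.
have [|x [xP [t [tP xE]] xmin]] := @seq_argmin R _ (dist1 b) (A `|` B) Q.
  exists q; first exact: memA.
  by exists 0; rewrite subr0 scale1r scale0r addr0; split=> //; lra.
have xb : x != b.
  apply/eqP => xb; have := dist1_gt0 qb.
  have := @dist1_seg b q t; rewrite -xE xb /dist1 !subrr normr0 addr0 => /(_ ltac:(lra)).
  by rewrite -/(dist1 b q); nra.
have xH : x = v \/ governs (slope x) b.
  have [->|xv] := eqVneq x v; [by left|right].
  by rewrite xE; apply: governs_seg; rewrite ?memA -?xE //; lra.
exists x, t; split=> //; split=> //; split=> //.
(* Suppose [x] is in [B], hence on the ray of [b]. If [q] is [v], then [x] is closer to [v] than
   [b], against [first b]; otherwise [q] lies on that ray as well, against the assumption on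
   slopes. *)
- move: xP; rewrite inE => /orP[//|xB]; exfalso.
  case: xH => [xv|/(slope_governed xB) sx]; first by have := B_neqv xB; rewrite xv eqxx.
  have Xx := XB_gt0 xB.
  have [qv|qv] := eqVneq q v.
    have := bmin _ xB (esym sx).
    by rewrite xE qv X_aff Xv; nra.
  have Xq := X_gt0 (memA qA) qv.
  have sq : slope q != slope b by case: H => [E|[]//]; rewrite E eqxx in qv.
  move/eqP: sq; apply.
  have Xb0 : X b != 0 by rewrite gt_eqF.
  have Xx0 : X x != 0 by rewrite gt_eqF.
  have Xq0 : X q != 0 by rewrite gt_eqF.
  have /eqP := sx; rewrite /slope eqr_div // => /eqP.
  rewrite xE X_aff Y_aff => E.
  apply/eqP; rewrite eqr_div //; apply/eqP.
  have : (1 - t) * (Y q * X b - Y b * X q) = 0 by lra.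
  move/eqP; rewrite mulf_eq0 => /orP[/eqP|/eqP]; lra.
- move=> p pP [u [uP pE]].
  (* A blocking point [p] would be another candidate on the segment from [q], strictly closer to [b]
     than [x]. *)
  have : dist1 b x <= dist1 b p.
    apply: xmin => //; exists (t + u - t * u); split; first by nra.
    by rewrite pE xE comb_seg.
  by rewrite pE dist1_seg; have := dist1_gt0 xb; nra.
Qed.

(** * Edges do not cross *)

Lemma oriented_edge_fun x b b' : x != v ->
  oriented_edge x b -> oriented_edge x b' -> b = b'.
Proof.
move=> /eqP xv [_ _ [//|g]] [_ _ [//|g']]; exact: governs_inj g g'.
Qed.

Lemma oriented_edge_memA x b : oriented_edge x b -> x \in A.
Proof. by case=> -[]. Qed.

Lemma oriented_edge_memB x b : oriented_edge x b -> b \in B.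
Proof. by case=> -[]. Qed.

(** Two segments into [b] that share a point other than [b] lie on one ray from [b], where the
    nearer endpoint would block the farther one. *)
Lemma visible_point_uniq x x' b p : bivisible A B x b -> bivisible A B x' b ->
  closed_segment x b p -> closed_segment x' b p -> p != b -> x = x'.
Proof.
have main (y y' : point) (t t' : R) : bivisible A B y b -> bivisible A B y' b ->
    0 <= t <= t' -> t' < 1 -> (1 - t) *: y + t *: b = (1 - t') *: y' + t' *: b -> y = y'.
  move=> [yA _ _] [_ _ vis] tP t'1 E.
  have t0 : 1 - t != 0 by lra.
  (* Contracting [y'] towards [b] by the ratio [r] gives [y]; if [r < 1], then [y] lies strictly
     between [y'] and [b]. *)
  have [r rE rP] : exists2 r : R, (1 - t) * r = 1 - t' & 0 < r <= 1.
    exists ((1 - t') / (1 - t)); first by rewrite mulrC divfK.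
    by rewrite divr_gt0 ?ler_pdivrMr //=; lra.
  have yE : y = (1 - (1 - r)) *: y' + (1 - r) *: b.
    apply/rowP => i; move/rowP/(_ i): E; rewrite !mxE subKr => E.
    apply: (mulfI t0); rewrite mulrDr !mulrA mulrBr mulr1 rE.
    by lra.
  have [r1|r1] := eqVneq r 1; first by rewrite yE r1 subrr subr0 scale1r scale0r addr0.
  case: (vis y (memA yA)); exists (1 - r); split=> //.
  have : r < 1 by rewrite lt_neqAle r1; case/andP: rP.
  by lra.
have end_lt (y : point) (t : R) : 0 <= t <= 1 -> p = (1 - t) *: y + t *: b -> p != b -> t < 1.
  move=> tP -> pb; rewrite lt_neqAle; apply/andP; split; last by lra.
  by apply: contra_neq pb => ->; rewrite subrr scale0r scale1r add0r.
move=> V V' [t [tP pE]] [t' [t'P p'E]] pb.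
have t1 := end_lt _ _ tP pE pb; have t'1 := end_lt _ _ t'P p'E pb.
have [tt'|t't] := leP t t'.
  by apply: (main _ _ t t') => //; [lra | rewrite -pE].
by apply/esym; apply: (main _ _ t' t) => //; [lra | rewrite -pE].
Qed.

(** [X] is nonnegative at [x] and positive at [b], so on the segment it can vanish only at [x]. *)
Lemma oriented_edge_at_v x b : oriented_edge x b -> closed_segment x b v -> x = v.
Proof.
move=> [[xA bB _] _ _] [t [tP vE]].
have := X_ge0 (memA xA); have := XB_gt0 bB => Xb Xx.
have : X v = (1 - t) * X x + t * X b by rewrite {1}vE X_aff.
rewrite Xv => E; have t0 : t = 0 by nra.
by rewrite vE t0 subr0 scale1r scale0r addr0.
Qed.

Lemma oriented_edges_non_crossing x b x' b' p :
  oriented_edge x b -> oriented_edge x' b' ->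
  closed_segment x b p -> closed_segment x' b' p ->
  [fset x; b] != [fset x'; b'] -> p \in [fset x; b] `&` [fset x'; b'].
Proof.
move=> e e' s s' ne; have [pv|pv] := eqVneq p v.
  subst p; rewrite (oriented_edge_at_v e s) (oriented_edge_at_v e' s').
  by rewrite !inE eqxx.
have gov y c : oriented_edge y c -> closed_segment y c p -> governs (slope p) c.
  move=> [[yA _ _] fc H] [t [tP pE]].
  by rewrite pE; apply: governs_seg; rewrite ?memA -?pE.
have bb' := governs_inj (gov _ _ e s) (gov _ _ e' s'); subst b'.
have [->|pb] := eqVneq p b; first by rewrite !inE eqxx !orbT.
case: e => V _ _; case: e' => V' _ _.
by case/eqP: ne; rewrite (visible_point_uniq V V' s s' pb).
Qed.

(** * Charging points to edges *)

Lemma line_through_ray b p : b \in B -> p \in A `|` B -> p != v -> slope p = slope b ->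
  line_through v b p.
Proof.
move=> bB pP pv sp; have Xb := XB_gt0 bB; have Xp := X_gt0 pP pv.
exists (X p / X b); apply: XY_inj.
  by rewrite X_aff Xv mulr0 add0r divfK // gt_eqF.
by rewrite Y_aff Yv mulr0 add0r (slopeE Xp) (slopeE Xb) sp mulrCA divfK // gt_eqF.
Qed.

Lemma line_through_sub (q b x : point) t : t < 1 -> x = (1 - t) *: q + t *: b ->
  forall p, line_through q b p -> line_through x b p.
Proof.
move=> t1 xE p [u ->]; exists ((u - t) / (1 - t)).
rewrite xE comb_seg.
have t0 : 1 - t != 0 by lra.
have -> : t + (u - t) / (1 - t) - t * ((u - t) / (1 - t)) = u by field.
by [].
Qed.

(* On the ray of [b] the uncharged point is [v], elsewhere it is [b]. *)
Definition charged x b p :=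
  [/\ line_through x b p, p != v & p = b -> line_through x b v].

(** Let [b] govern the slope of [q]. If [q] is on the ray of [b], walking from [v] to [b] yields an
    edge on that ray; otherwise walking from [q] itself yields an edge on the line through [q] and
    [b]. *)
Lemma charge_exists q : q \in A `|` B -> q != v ->
  exists x b, oriented_edge x b /\ charged x b q.
Proof.
move=> qP qv; have [b gb] := governs_exists (slope q).
have fb := gb.1; have bB := fb.1.
have [sq|sq] := eqVneq (slope q) (slope b).
  have [//|x [t [tP xE e]]] := @edge_toward v b vA fb; first by left.
  have sub := line_through_sub (proj2 (andP tP)) xE.
  exists x, b; split=> //; split=> //.
    by apply: sub; exact: line_through_ray.
  move=> _; apply: sub; exists 0.
  by rewrite subr0 scale1r scale0r addr0.
have qA : q \in A.
  move: qP; rewrite inE => /orP[//|qB].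
  by rewrite (slope_governed qB gb) eqxx in sq.
have [|x [t [tP xE e]]] := @edge_toward q b qA fb; first by right.
exists x, b; split=> //; split=> //.
  apply: (line_through_sub (proj2 (andP tP)) xE); exists 0.
  by rewrite subr0 scale1r scale0r addr0.
by move=> qb; rewrite qb eqxx in sq.
Qed.

(** * The graph of all these edges is a non-crossing forest *)

Definition star_edges : {fset {fset point}} :=
  [fset e in bivis_edges A B | `[< exists x b, e = [fset x; b] /\ oriented_edge x b >]].

Lemma star_edgesP e :
  reflect (exists x b, e = [fset x; b] /\ oriented_edge x b) (e \in star_edges).
Proof.
apply: (iffP idP) => [|[x [b [-> eb]]]].
  by rewrite !inE /= => /andP[_ /asboolP].
have [V _ _] := eb; have [xA bB _] := V.
rewrite !inE /= fpowersetE; apply/andP; split; last first.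
  by apply/asboolP; exists x, b.
apply/and3P; split.
- by apply/fsubsetP => p; rewrite !inE => /orP[]/eqP->; rewrite ?xA ?bB ?orbT.
- rewrite cardfs2; suff -> : x != b by [].
  by apply/eqP => xb; apply: (@notAB b) => //; rewrite -xb.
- by apply/asboolP; exists x, b.
Qed.

Lemma star_edges_sub e : e \in star_edges -> e `<=` A `|` B /\ #|` e| = 2%N.
Proof. by rewrite inE /= => /andP[/bivis_edgesP]. Qed.

Definition star_graph : sgraph point := SGraph star_edges_sub.

Lemma star_graph_subgraph : subgraph star_graph (bivisibility_graph A B).
Proof.
split; first exact: fsubset_refl.
by apply/fsubsetP => e /=; rewrite inE /= => /andP[].
Qed.

Lemma star_graph_adj x y : adj star_graph x y -> oriented_edge x y \/ oriented_edge y x.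
Proof.
by move/star_edgesP => [a [b [/fset2_eq[[-> ->]|[-> ->]] e]]]; [left|right].
Qed.

Lemma star_graph_adj_sym x y : adj star_graph x y = adj star_graph y x.
Proof. by rewrite /adj fsetUC. Qed.

Lemma star_graph_adjA x y : x \in A -> adj star_graph x y -> oriented_edge x y.
Proof. by move=> xA /star_graph_adj[//|/oriented_edge_memB/(notAB xA)]. Qed.

Lemma star_graph_adjB x y : x \in B -> adj star_graph x y -> oriented_edge y x.
Proof. by move=> xB /star_graph_adj[/oriented_edge_memA/notAB/(_ xB)|]. Qed.

Lemma star_graph_non_crossing : non_crossing star_graph.
Proof.
move=> e f /star_edgesP[x [b [-> eb]]] /star_edgesP[x' [b' [-> eb']]] ne p.
rewrite !drawn_edgeE => s s'; exact: oriented_edges_non_crossing.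
Qed.

(* Every vertex of A other than v has degree at most one. *)
Lemma star_graph_forest : forest star_graph.
Proof.
move=> c sc cyc.
have onlyv x : x \in c -> x \in A -> x = v.
  move=> xc xA; have [y [w [_ _ yw exy ewx]]] := ucycle_neighbors cyc sc xc.
  have [//|xv] := eqVneq x v; case/eqP: yw.
  rewrite star_graph_adj_sym in ewx.
  by apply: (oriented_edge_fun xv); exact: star_graph_adjA.
(* The two distinct neighbours on the cycle of a vertex in [B] would both be in [A], hence both
   equal to [v]. *)
have noB x : x \in c -> x \in B -> False.
  move=> xc xB; have [y [w [yc wc yw exy ewx]]] := ucycle_neighbors cyc sc xc.
  rewrite star_graph_adj_sym in ewx.
  have yA := oriented_edge_memA (star_graph_adjB xB exy).
  have wA := oriented_edge_memA (star_graph_adjB xB ewx).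
  by move: yw; rewrite (onlyv _ yc yA) (onlyv _ wc wA) eqxx.
case: c sc cyc onlyv noB => // x0 c sc cyc _ noB.
(* Every edge has an endpoint in [B], so no cycle is left. *)
have [y [w [yc wc _ exy _]]] := ucycle_neighbors cyc sc (mem_head _ _).
have [/oriented_edge_memB|/oriented_edge_memB] := star_graph_adj exy.
  exact: noB.
by apply: noB; exact: mem_head.
Qed.

(** * Counting edges by the points charged to them *)

Variable l : nat.
Hypothesis AB_line_le : forall L : set point, AB_line A B L ->
  (#|` [fset p in A `|` B | p \in L]| <= l)%N.

Lemma line_through_left (a b : point) : line_through a b a.
Proof. by exists 0; rewrite subr0 scale1r scale0r addr0. Qed.

Lemma line_through_right (a b : point) : line_through a b b.
Proof. by exists 1; rewrite subrr scale1r scale0r add0r. Qed.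

Lemma AB_line_through a b : a \in A -> b \in B -> AB_line A B (line_through a b).
Proof.
move=> aA bB; split.
- by apply: is_line_through; apply/eqP => ab; apply: (@notAB b) => //; rewrite -ab.
- by exists a => //; exact: line_through_left.
- by exists b => //; exact: line_through_right.
Qed.

Lemma card_on_line a b (D : {fset point}) : a \in A -> b \in B ->
  D `<=` A `|` B -> (forall p, p \in D -> line_through a b p) -> (#|` D| <= l)%N.
Proof.
move=> aA bB DP DL; apply: leq_trans (AB_line_le (AB_line_through aA bB)).
apply: fsubset_leq_card; apply/fsubsetP => p pD; rewrite !inE /=.
by move/fsubsetP/(_ _ pD): DP; rewrite inE => -> /=; apply/mem_set/DL.
Qed.

(** The line through [v] and any point of [B] carries two points; this makes the denominator [l - 1]
    positive. *)
Lemma line_bound_gt1 : (1 < l)%N.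
Proof.
have /fset0Pn[b bB] := B_neq0.
have := @card_on_line v b [fset v; b] vA bB.
rewrite cardfs2 eq_sym B_neqv //; apply.
  by apply/fsubsetP => p; rewrite !inE => /orP[]/eqP->; rewrite ?vA ?bB ?orbT.
move=> p; rewrite !inE => /orP[]/eqP->; [exact: line_through_left|exact: line_through_right].
Qed.

Definition charges (e : {fset point}) : {fset point} :=
  [fset p in A `|` B | `[< exists x b, [/\ e = [fset x; b], oriented_edge x b & charged x b p] >]].

Lemma card_charges e : e \in star_edges -> (#|` charges e| <= l.-1)%N.
Proof.
move=> /star_edgesP[x [b [-> eb]]].
have xA := oriented_edge_memA eb; have bB := oriented_edge_memB eb.
have chP p : p \in charges [fset x; b] -> p \in A `|` B /\ charged x b p.
  rewrite !inE /= => /andP[-> /asboolP[x' [b' [/fset2_eq[[-> ->]|[E1 E2]] eb' ch]]]] //.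
  by case: (@notAB b') => //; [rewrite -E1 | exact: oriented_edge_memB eb'].
(* An uncharged point [z] on the line of the edge brings the bound down from [l] to [l - 1]. *)
have [z [zP zL zch]] : exists z, [/\ z \in A `|` B, line_through x b z & z \notin charges [fset x; b]].
  have [Lv|nLv] := pselect (line_through x b v).
    exists v; split=> //; first exact: memA.
    by apply/negP => /chP[_ []]; rewrite eqxx.
  exists b; split; [exact: memB|exact: line_through_right|].
  by apply/negP => /chP[_ [_ _ /(_ erefl)]].
have := @card_on_line x b (z |` charges [fset x; b]) xA bB.
rewrite cardfsU1 zch add1n => H.
suff: (#|` charges [fset x; b]| < l)%N by case: (l).
apply: H.
  by apply/fsubsetP => p; rewrite in_fset1U => /orP[/eqP->//|/chP[]].
by move=> p; rewrite in_fset1U => /orP[/eqP->//|/chP[_ []]].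
Qed.

(** The successor accounts for [v], the one point that is never charged. *)
Lemma card_star_edges : (#|` A `|` B| <= (l.-1 * #|` star_edges|).+1)%N.
Proof.
rewrite (cardfsD1 v) (memA vA) add1n ltnS; apply: (@card_fset_cover _ _ _ charges).
  move=> q; rewrite in_fsetD1 => /andP[qv qP].
  have [x [b [eb ch]]] := charge_exists qP qv.
  exists [fset x; b]; first by apply/star_edgesP; exists x, b.
  by rewrite !inE /= in qP *; rewrite qP; apply/asboolP; exists x, b.
exact: card_charges.
Qed.

(** * The spanning tree when [l] is 2 *)

Lemma three_on_line a b p q r : l = 2%N -> a \in A -> b \in B ->
  [&& p \in A `|` B, q \in A `|` B & r \in A `|` B] ->
  line_through a b p -> line_through a b q -> line_through a b r ->
  p != q -> q != r -> p = r.
Proof.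
move=> l2 aA bB /and3P[pP qP rP] Lp Lq Lr pq qr; apply/eqP/negPn/negP => pr.
have := @card_on_line a b (p |` [fset q; r]) aA bB.
rewrite cardfsU1 cardfs2 !inE negb_or pq pr qr l2 /= => H.
suff: (3 <= 2)%N by [].
apply: H.
  by apply/fsubsetP => z; rewrite in_fset1U in_fset2 => /or3P[]/eqP->.
by move=> z; rewrite in_fset1U in_fset2 => /or3P[]/eqP->.
Qed.

(** With only two points on each such line nothing blocks a walk. So each first point of a ray is
    adjacent to [v], every other point of [A] to its governing point, and [v] is at most two steps
    away. *)
Lemma star_graph_path_v x : l = 2%N -> x \in A `|` B ->
  exists2 p, path (adj star_graph) x p & last x p = v.
Proof.
move=> l2 xP.
have edgeadj a b : oriented_edge a b -> adj star_graph b a.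
  by move=> e; rewrite star_graph_adj_sym; apply/star_edgesP; exists a, b.
have ray b q : b \in B -> q \in A `|` B -> q != v -> slope q = slope b -> q = b.
  move=> bB qP qv sq.
  have Lq := line_through_ray bB qP qv sq.
  apply: (three_on_line l2 vA bB _ Lq (line_through_left v b) (line_through_right v b)) => //.
    by rewrite qP (memA vA) memB.
  by rewrite eq_sym B_neqv.
have direct q b : q \in A -> first b ->
    q = v \/ (governs (slope q) b /\ slope q != slope b) -> oriented_edge q b.
  move=> qA fb /(edge_toward qA fb)[y [t [tP yE e]]].
  have yA := oriented_edge_memA e; have bB := fb.1.
  (* The point [y] reached from [q] shares a line with [q] and [b], and it is not [b]. *)
  suff <- : y = q by [].
  apply: (three_on_line (q := b) l2 qA bB).
  - by rewrite (memA yA) (memB bB) memA.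
  - by rewrite yE; exists t.
  - exact: line_through_right.
  - exact: line_through_left.
  - by apply/eqP => yb; apply: (@notAB y) => //; rewrite yb.
  - by apply/eqP => yb; apply: (@notAB q) => //; rewrite -yb.
have pathB b : first b -> adj star_graph b v.
  by move=> fb; apply/edgeadj/direct => //; left.
have [->|xv] := eqVneq x v; first by exists [::].
have [b gb] := governs_exists (slope x).
have [E|nE] := eqVneq (slope x) (slope b).
  exists [:: v] => //=; rewrite andbT.
  by rewrite (ray b x gb.1.1) //; apply: pathB; exact: gb.1.
have xA : x \in A.
  move: xP; rewrite inE => /orP[//|xB].
  by rewrite (slope_governed xB gb) eqxx in nE.
exists [:: b; v] => //=; rewrite (pathB b gb.1) !andbT.
rewrite star_graph_adj_sym; apply/edgeadj/direct => //; first exact: gb.1.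
by right.
Qed.

Lemma star_graph_tree : l = 2%N -> tree star_graph.
Proof.
move=> l2; split; last exact: star_graph_forest.
  by apply/fset0Pn; exists v; exact: memA.
(* Walk from [x] to [v], then along the path from [y] to [v] reversed. *)
move=> x y /(star_graph_path_v l2)[p pp lp] /(star_graph_path_v l2)[q pq lq].
exists (p ++ rev (belast y q)).
  rewrite cat_path pp lp -lq rev_path.
  by rewrite (eq_path (e' := adj star_graph)) // => a b; exact: star_graph_adj_sym.
by rewrite last_cat lp -lq; case: (q) => //= a q'; rewrite rev_cons last_rcons.
Qed.

End Construction.

(** * Choosing the extreme point and the coordinates *)

Lemma rV2_eq (R : realType) (p q : 'rV[R]_2) : p 0 0 = q 0 0 -> p 0 1 = q 0 1 -> p = q.
Proof.
move=> E0 E1; apply/rowP => i; case: i => -[|[|//]] lti.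
  by rewrite (_ : Ordinal lti = 0) //; exact: val_inj.
by rewrite (_ : Ordinal lti = 1) //; exact: val_inj.
Qed.

Lemma exists_injective_functional (R : realType) (D : {fset 'rV[R]_2}) :
  exists k : R, forall p q, p \in D -> q \in D ->
    p 0 0 + k * p 0 1 = q 0 0 + k * q 0 1 -> p = q.
Proof.
(* For points with distinct second coordinates, the listed quotient is the only [k] at which the
   functional ties; finitely many values are to be avoided. *)
have [k kP] := exists_notin
  [seq (q 0 0 - p 0 0) / (p 0 1 - q 0 1) | p : 'rV[R]_2 <- D, q : 'rV[R]_2 <- D].
exists k => p q pD qD E.
have E1 : p 0 1 = q 0 1.
  apply/eqP; rewrite -subr_eq0; apply: contraNT kP => ne.
  apply/allpairsP; exists (p, q); split=> //=.
  by apply: (mulIf ne); rewrite divfK //; lra.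
by apply: rV2_eq => //; rewrite E1 in E; lra.
Qed.

(** The conclusion is packaged so that it can be transferred under exchanging [A] and [B]. *)
Definition has_forest_and_tree (R : realType) (A B : {fset 'rV[R]_2}) (l : nat) :=
  (exists F : sgraph 'rV[R]_2,
     [/\ subgraph F (bivisibility_graph A B), forest F, non_crossing F &
         (#|` A `|` B|%:R - 1) / (l%:R - 1) <= #|` edges F|%:R :> R]) /\
  (l = 2%N ->
   exists T : sgraph 'rV[R]_2,
     [/\ spanning T (bivisibility_graph A B), tree T & non_crossing T]).

Lemma has_forest_and_treeC (R : realType) (A B : {fset 'rV[R]_2}) l :
  has_forest_and_tree A B l -> has_forest_and_tree B A l.
Proof.
rewrite /has_forest_and_tree /spanning /subgraph /=.
by rewrite (fsetUC B A) (bivis_edgesC B A).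
Qed.

Lemma forest_and_tree_of_extreme_point (R : realType) (A B : {fset 'rV[R]_2})
    (l : nat) (k : R) (v : 'rV[R]_2) :
  [disjoint A & B] -> B != fset0 ->
  (forall L : set 'rV[R]_2, AB_line A B L ->
     (#|` [fset p in A `|` B | p \in L]| <= l)%N) ->
  v \in A ->
  (forall p, p \in A `|` B -> p != v -> v 0 0 + k * v 0 1 < p 0 0 + k * p 0 1) ->
  has_forest_and_tree A B l.
Proof.
move=> dAB B0 lle vA vmin.
(* The functional minimised at [v], recentred there; the second coordinate completes it to an affine
   coordinate system. *)
pose X (p : 'rV[R]_2) := p 0 0 + k * p 0 1 - (v 0 0 + k * v 0 1).
pose Y (p : 'rV[R]_2) := p 0 1 - v 0 1.
have Xaff (t : R) (a b : 'rV[R]_2) : X ((1 - t) *: a + t *: b) = (1 - t) * X a + t * X b.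
  by rewrite /X !mxE; ring.
have Yaff (t : R) (a b : 'rV[R]_2) : Y ((1 - t) *: a + t *: b) = (1 - t) * Y a + t * Y b.
  by rewrite /Y !mxE; ring.
have inj p q : X p = X q -> Y p = Y q -> p = q.
  rewrite /X /Y => EX EY.
  have E1 : p 0 1 = q 0 1 by lra.
  rewrite E1 in EX; have E0 : p 0 0 = q 0 0 by lra.
  exact: rV2_eq.
have Xv : X v = 0 by rewrite /X subrr.
have Yv : Y v = 0 by rewrite /Y subrr.
have Xpos p : p \in A `|` B -> p != v -> 0 < X p by move=> pP pv; rewrite subr_gt0 vmin.
pose F := star_graph A B v X Y.
have Fsub : subgraph F (bivisibility_graph A B) by exact: star_graph_subgraph.
have Fnc : non_crossing F by exact: star_graph_non_crossing.
split; last first.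
  by move=> l2; exists F; split=> //; exact: (star_graph_tree dAB vA B0 Xaff Yaff inj Xv Yv Xpos lle).
exists F; split=> //; first exact: star_graph_forest.
have l1 : (1 < l)%N by exact: (line_bound_gt1 dAB vA B0 lle).
have l1R : (1 : R) < l%:R by rewrite ltr1n.
rewrite ler_pdivrMr ?subr_gt0 //.
have : (#|` A `|` B| <= (l.-1 * #|` edges F|).+1)%N by exact: card_star_edges.
rewrite -(ler_nat R) -natr1 natrM -subn1 natrB 1?ltnW //.
by lra.
Qed.

Theorem theorem14 (R : realType) (A B : {fset 'rV[R]_2}) (n l : nat)
    (card_AB : #|` A `|` B| = n) (disj_AB : [disjoint A & B])
    (A_neq0 : A != fset0) (B_neq0 : B != fset0)
    (AB_line_le : forall L : set 'rV[R]_2, AB_line A B L ->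
       (#|` [fset p in A `|` B | p \in L]| <= l)%N) :
  (exists F : sgraph 'rV[R]_2,
     [/\ subgraph F (bivisibility_graph A B), forest F, non_crossing F &
         (n%:R - 1) / (l%:R - 1) <= #|` edges F|%:R :> R]) /\
  (l = 2%N ->
   exists T : sgraph 'rV[R]_2,
     [/\ spanning T (bivisibility_graph A B), tree T & non_crossing T]).
Proof.
rewrite -card_AB -/(has_forest_and_tree A B l).
have [k kinj] := exists_injective_functional (A `|` B).
have /fset0Pn[a0 a0A] := A_neq0.
(* The injective functional has a unique minimiser [v] on the configuration, which serves as the
   extreme point. *)
have [|v [vP _ vmin]] := @seq_argmin R _ (fun p : 'rV[R]_2 => p 0 0 + k * p 0 1)
    (A `|` B) (fun=> True).
  by exists a0 => //; rewrite inE a0A.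
have vlt p : p \in A `|` B -> p != v -> v 0 0 + k * v 0 1 < p 0 0 + k * p 0 1.
  move=> pP pv; rewrite lt_neqAle vmin // andbT.
  by apply: contra_neq pv => /(kinj _ _ vP pP).
have /orP[vA|vB] : (v \in A) || (v \in B) by rewrite inE in vP.
  exact: forest_and_tree_of_extreme_point vlt.
(* The extreme point lies in [B], so the two colours exchange roles. *)
apply: has_forest_and_treeC.
apply: (@forest_and_tree_of_extreme_point _ _ _ _ k v) => //.
- by rewrite fdisjoint_sym.
- by move=> L /AB_lineC/AB_line_le; rewrite fsetUC.
- by move=> p; rewrite fsetUC; exact: vlt.
Qed.
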